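(* Let $(X,T)$ be a Polish dynamical system. For every closed $V\subseteq\mathcal{M}_T(X)$ the set $G_V=\{x\in X: V(x)\subseteq V\}$ is co-analytic (is $\boldsymbol{\Pi}^1_1$).
   Context: A Polish dynamical system $(X,T)$ is a Polish space $X$ (not assumed compact) with a continuous map $T\colon X\to X$. $\mathcal{M}(X)$ is the space of Borel probability measures on $X$ with the weak$^*$ topology (convergence of integrals of bounded continuous functions); $\mathcal{M}_T(X)$ is the subspace of $T$-invariant measures. For $x\in X$, $n\ge1$, $\mathcal{E}(x,n)=\frac1n\sum_{j=0}^{n-1}\delta_{T^j(x)}$, and $V(x)$ is the set of limit points (limits of convergent subsequences) in $\mathcal{M}(X)$ of $(\mathcal{E}(x,n))_n$. *)

(* Defs.v *)
From HB Require Import structures.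
From mathcomp Require Import all_boot all_order all_algebra.
From mathcomp Require Import all_classical all_reals all_analysis.

Set Implicit Arguments.
Unset Strict Implicit.
Unset Printing Implicit Defensive.

Import Order.TTheory GRing.Theory Num.Theory.
Import numFieldNormedType.Exports.

Local Open Scope classical_set_scope.
Local Open Scope ring_scope.

Section polish.
Variables (R : realType) (X : topologicalType).

Definition is_metric (d : X -> X -> R) :=
  [/\ forall x, d x x = 0,
      forall x y, d x y = 0 -> x = y,
      forall x y, d x y = d y x
    & forall y x z, d x z <= d x y + d y z].

Definition metrizes (d : X -> X -> R) :=
  forall x : X,
    nbhs x = filter_from [set e : R | 0 < e] (fun e => [set y | d x y < e]).

Definition complete_metric (d : X -> X -> R) :=
  forall u : nat -> X,
    (forall e : R, 0 < e -> exists N : nat, forall m n : nat,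
        (N <= m)%N -> (N <= n)%N -> d (u m) (u n) < e) ->
    exists l : X, u @ \oo --> l.

Definition separable := exists2 D : set X, countable D & dense D.

(* A property of the topology: no particular metric is part of the data. *)
Definition polish :=
  separable /\
  exists d : X -> X -> R, [/\ is_metric d, metrizes d & complete_metric d].

End polish.

Section analytic.
Variables (R : realType) (X : topologicalType).

(* [Y] ranges over possibly empty spaces, so that [set0] is analytic. *)
Definition analytic (A : set X) :=
  exists (Y : topologicalType) (f : Y -> X),
    [/\ polish R Y, continuous f & range f = A].

Definition coanalytic (A : set X) := analytic (~` A).

End analytic.

Definition borel (X : ptopologicalType) := g_sigma_algebraType (@open X).

HB.instance Definition _ (X : ptopologicalType) :=
  Measurable.copy (borel X) (g_sigma_algebraType (@open X)).

Section weak_star.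
Variables (R : realType) (X : ptopologicalType).

Definition Cb := {f : X -> R | continuous f /\ bounded_fun f}.

Definition integrals (mu : probability (borel X) R) : {ptws Cb -> R} :=
  fun f => \int[mu]_x (sval f x).

(* The weak* topology is the coarsest one making every [mu |-> \int[mu] f],
   [f : Cb], continuous. A [probability] also carries values on non-Borel sets;
   two that agree on Borel sets are topologically indistinguishable here. *)
Definition borel_prob := initial_topology integrals.

HB.instance Definition _ := Topological.copy borel_prob
  (initial_topology integrals).

End weak_star.

Section dynamics.
Variables (R : realType) (X : ptopologicalType) (T : X -> X).

Definition invariant_prob : set (borel_prob R X) :=
  [set mu : probability (borel X) R |
    forall A : set (borel X), measurable A -> mu (T @^-1` A) = mu A].

(* [empirical x n] is the average of the Dirac masses at the first [n.+1]
   points of the orbit of [x], i.e. the usual E(x, n + 1). *)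
Definition empirical (x : X) (n : nat) : set (borel X) -> \bar R :=
  mscale (n.+1%:R^-1)%:nng
    (msum (fun j => \d_(iter j T x : borel X)) n.+1).

HB.instance Definition _ x n := Measure.on (empirical x n).

Let empirical_setT x n : empirical x n setT = 1%E.
Proof.
rewrite /empirical /mscale /=.
have -> : msum (fun j => \d_(iter j T x : borel X)) n.+1 setT
    = n.+1%:R%:E :> \bar R.
  rewrite /msum (eq_bigr (fun=> 1%E)); last by move=> i _; exact: diracT.
  by rewrite sumEFin sumr_const card_ord.
by rewrite -EFinM mulVf.
Qed.

HB.instance Definition _ x n :=
  Measure_isProbability.Build _ _ _ (empirical x n) (empirical_setT x n).

Definition empirical_prob (x : X) (n : nat) : borel_prob R X :=
  (empirical x n : probability (borel X) R).

Definition limit_measures (x : X) : set (borel_prob R X) :=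
  [set mu | exists2 s : nat -> nat, {homo s : i j / (i < j)%N} &
    (fun k => empirical_prob x (s k)) @ \oo --> mu].

Definition G_ (V : set (borel_prob R X)) : set X :=
  [set x | limit_measures x `<=` V].

End dynamics.

(* Main.v *)
(* A point [x] lies outside [G_V] iff some subsequence of its empirical measures
   converges to a measure outside [V], and this is witnessed by a sequence of
   natural numbers subject to closed conditions on [x], so that the complement
   of [G_V] is obtained by the Souslin operation from closed sets. The witness
   records the times of a subsequence, finite families of small balls showing
   that the subsequence is tight, and a box, given by finitely many test
   functions and integers, that contains the subsequence and is disjoint from
   [V]. Two facts make this work. First, countably many test functions (finite
   maxima of bumps around a dense sequence) give a countable neighbourhood base
   at every measure. Second, a tight sequence has a weak* limit along every
   ultrafilter: the limits of the masses of open sets form a modular set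
   function, the outer measure obtained from it by covering with open sets is
   additive on sets separated by disjoint open sets, hence a Borel measure by
   the Caratheodory criterion, and tightness together with completeness
   prevents any loss of mass. *)

Require Import Defs.
From HB Require Import structures.
From mathcomp Require Import all_boot all_order all_algebra.
From mathcomp Require Import all_classical all_reals all_analysis.
From mathcomp Require Import measurable_realfun lra zify.

Set Implicit Arguments.
Unset Strict Implicit.
Unset Printing Implicit Defensive.

Import Order.TTheory GRing.Theory Num.Theory.
Import numFieldNormedType.Exports.

Local Open Scope classical_set_scope.
Local Open Scope ring_scope.

(** * Weak* convergence and integrals of bounded continuous functions *)

Section weak_star_topology.
Variables (R : realType) (X : ptopologicalType).
Implicit Types (mu nu : borel_prob R X) (f : Cb R X).

Lemma integrals_continuous f : continuous (fun mu => integrals mu f).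
Proof.
move=> mu; apply: (@continuous_comp _ {ptws Cb R X -> R} _
  (@integrals R X : borel_prob R X -> _) (fun h => h f)).
  exact: initial_continuous.
set h := integrals mu.
have /cvg_sup/(_ f) hf : (h : {ptws Cb R X -> R}) --> h by exact: cvg_id.
move=> A /(@initial_continuous _ _ (fun g : Cb R X -> R => g f) h) Af.
exact: hf Af.
Qed.

(** Basic open sets are preimages under [integrals], and pointwise convergence is tested coordinate
    by coordinate; constant functions show that the evaluations are onto. *)
Lemma cvg_borel_prob (F : set_system (borel_prob R X)) mu : Filter F ->
  (forall f, (fun nu => integrals nu f) @ F --> integrals mu f) -> F --> mu.
Proof.
move=> FF Ff A [_ [[B Bop <-] Bfs sBA]]; apply: filterS sBA _.
have : (@integrals R X) @ F --> (integrals mu : {ptws Cb R X -> R}).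
  apply/cvg_sup => f; apply/cvg_image;
    first by rewrite eqEsubset; split=> y // _; exists (fun=> y).
  move=> C /Ff/= FC; exists ((fun h : {ptws Cb R X -> R} => h f) @^-1` C) => //.
  by rewrite eqEsubset; split => [_ [h hC <-]//|y Cy]; exists (fun=> y).
by apply; apply: open_nbhs_nbhs.
Qed.

Lemma open_gt_continuous (f : X -> R) (c : R) :
  continuous f -> open [set x | c < f x].
Proof. by move=> /continuousP/(_ _ (@open_gt R c)). Qed.

Lemma closed_le_continuous (f : X -> R) (c : R) :
  continuous f -> closed [set x | f x <= c].
Proof.
move=> cf; rewrite (_ : mkset _ = ~` [set x | c < f x]).
  exact: open_closedC (open_gt_continuous _ cf).
by apply/seteqP; split => x /=; rewrite leNgt => /negP.
Qed.

Lemma open_measurable_borel (U : set X) : open U -> measurable (U : set (borel X)).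
Proof. exact: sub_sigma_algebra. Qed.

Lemma continuous_measurable_borel (f : X -> R) :
  continuous f -> measurable_fun [set: borel X] (f : borel X -> R).
Proof.
move=> /continuousP cf; apply: (measurability _ (RGenOInfty.measurableE R)).
move=> _ [_ [a ->] <-]; rewrite setTI.
by apply: sub_sigma_algebra; apply: cf; exact: interval_open.
Qed.

Lemma Cb_integrable (P : probability (borel X) R) f :
  P.-integrable setT (EFin \o (sval f : borel X -> R)).
Proof.
case: f => f [cf bf] /=; apply: measurable_bounded_integrable => //.
- by apply: le_lt_trans (probability_le1 _ _) _; rewrite ?ltry.
- exact: continuous_measurable_borel.
Qed.

(** Counting the multiples of [eta] in [[0, y)] rounds [y] up to a multiple of [eta]. *)
Lemma staircase_bounds (eta y : R) (n : nat) : 0 < eta -> 0 <= y <= eta *+ n ->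
  y <= eta * \sum_(i < n) (eta *+ i < y)%R%:R <= y + eta.
Proof.
move=> eta0 /andP[y0 yn]; set S := fun n : nat => eta * \sum_(i < n) (eta *+ i < y)%R%:R.
have SS k : S k.+1 = S k + eta * (eta *+ k < y)%R%:R.
  by rewrite /S big_ord_recr/= mulrDr.
have S0 : S 0%N = 0 by rewrite /S big_ord0 mulr0.
(* Until the partial sum reaches [y], every term counts, so it equals [eta *+ k]. *)
have H k : [/\ (y <= S k) || (eta *+ k <= S k), S k <= eta *+ k & S k <= y + eta].
  elim: k => [|k [lo up1 up2]]; first by rewrite S0 mulr0n lexx orbT; split=> //; lra.
  rewrite SS mulrSr; have [ky|yk] := ltP (eta *+ k) y; rewrite ?mulr1 ?mulr0.
    by split; [case/orP: lo => ?; apply/orP; [left|right]; lra|lra|lra].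
  by split; [case/orP: lo => ?; apply/orP; left; lra|lra|lra].
have [/orP lo _ up] := H n; rewrite -/(S n) up andbT.
by case: lo => // /(le_trans yn).
Qed.

(** A discrete layer cake formula: adding [M] makes [f] nonnegative, and the staircase over its
    superlevel sets is integrated. It reduces integrals to masses of open sets. *)
Lemma layer_sum_bounds (P : probability (borel X) R) f (M eta : R) (n : nat) :
  0 < eta -> (forall x, `|sval f x| <= M) -> M *+ 2 <= eta *+ n ->
  \int[P]_x (sval f x)
    <= eta * (\sum_(i < n) fine (P [set x | eta *+ i < sval f x + M])) - M
    <= \int[P]_x (sval f x) + eta.
Proof.
move=> eta0 fM Mn; set S := \sum_(i < n) _.
pose U (i : nat) : set (borel X) := [set x | eta *+ i < sval f x + M].
have mU i : measurable (U i).
  rewrite (_ : U i = [set x | eta *+ i - M < sval f x]); last first.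
    by apply/seteqP; split => x /=; rewrite ltrBlDr.
  by apply: open_measurable_borel; apply: open_gt_continuous; case: (f) => ? [].
have iU i : P.-integrable setT (EFin \o (\1_(U i) : borel X -> R)) by exact: integrable_indic.
have iC (c : R) : P.-integrable setT (EFin \o cst c) by exact: finite_measure_integrable_cst.
have intC (c : R) : \int[P]_x (cst c x) = c.
  rewrite Rintegral_cst// [X in fine X](_ : _ = 1%E) ?mulr1//.
  exact: probability_setT.
pose g (k : nat) (x : borel X) : R := \sum_(i < k) \1_(U i) x.
have ig k : P.-integrable setT (EFin \o g k) /\
    \int[P]_x (g k x) = \sum_(i < k) fine (P (U i)).
  elim: k => [|k [ik Ek]].
    rewrite big_ord0 (_ : g 0%N = cst 0); last by apply/funext => x; rewrite /g big_ord0.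
    by split => //; rewrite Rintegral_cst// mul0r.
  rewrite (_ : g k.+1 = g k \+ \1_(U k)); last first.
    by apply/funext => x; rewrite /g big_ord_recr.
  split.
    rewrite (_ : EFin \o _ = (EFin \o g k) \+ (EFin \o \1_(U k)))//.
    exact: integrableD.
  rewrite RintegralD// Ek big_ord_recr/=; congr (_ + _).
  by rewrite /Rintegral integral_indic// setIT.
have [ign Eg] := ig n.
have iG : P.-integrable setT (EFin \o (fun x => eta * g n x - M)).
  rewrite (_ : EFin \o _ = (EFin \o (fun x => eta * g n x)) \+ (EFin \o cst (- M)))//.
  apply: integrableD => //.
  rewrite (_ : EFin \o _ = (fun x => eta%:E * (EFin \o g n) x)%E)//.
  exact: integrableZl.
have EG : \int[P]_x (eta * g n x - M) = eta * S - M.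
  rewrite (RintegralD _ (f1 := fun x => eta * g n x) (f2 := cst (- M)))//.
    by rewrite RintegralZl// Eg intC.
  rewrite (_ : EFin \o _ = (fun x => eta%:E * (EFin \o g n) x)%E)//.
  exact: integrableZl.
have ptw x : sval f x <= eta * g n x - M <= sval f x + eta.
  have := fM x; rewrite ler_norml => /andP[f1 f2].
  have /(staircase_bounds eta0) : 0 <= sval f x + M <= eta *+ n.
    by apply/andP; split; lra.
  rewrite (_ : \sum_(i < n) _ = g n x) => [/andP[? ?]|]; first by apply/andP; split; lra.
  apply: eq_bigr => i _; rewrite indicE; congr (nat_of_bool _)%:R.
  by apply/idP/idP => [h|]; [rewrite inE|rewrite inE].
rewrite -EG; apply/andP; split.
  apply: le_Rintegral => //; first exact: Cb_integrable.
  by move=> x _; have /andP[] := ptw x.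
rewrite -[X in _ + X](_ : \int[P]_x (cst eta x) = eta); last first.
  exact: intC.
rewrite -RintegralD//; last exact: Cb_integrable.
apply: le_Rintegral => //.
  rewrite (_ : EFin \o _ = (EFin \o sval f) \+ (EFin \o cst eta))//.
  by apply: integrableD => //; exact: Cb_integrable.
by move=> x _; have /andP[] := ptw x.
Qed.

End weak_star_topology.

(** * Masses of open sets and the portmanteau criterion *)

Section portmanteau.
Variables (R : realType) (X : ptopologicalType).
Implicit Types (mu nu : borel_prob R X) (f : Cb R X) (U : set X).

Definition mass mu U : R := fine ((mu : probability (borel X) R) (U : set (borel X))).

Lemma mass_EFin mu U : open U ->
  ((mu : probability (borel X) R) (U : set (borel X)) = (mass mu U)%:E)%E.
Proof. by move=> /open_measurable_borel mU; rewrite /mass fineK// fin_num_measure. Qed.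

Lemma mass0 mu : mass mu set0 = 0.
Proof. by rewrite /mass measure0. Qed.

Lemma massT mu : mass mu setT = 1.
Proof. by rewrite /mass [X in fine X](_ : _ = 1%E)//; exact: probability_setT. Qed.

Lemma le_mass mu U V : open U -> open V -> U `<=` V -> mass mu U <= mass mu V.
Proof.
move=> oU oV UV; rewrite -lee_fin -!mass_EFin//.
by apply: le_measure => //; rewrite inE; exact: open_measurable_borel.
Qed.

Lemma mass_unit mu U : open U -> 0 <= mass mu U <= 1.
Proof.
move=> oU; rewrite -{1}(mass0 mu) -(massT mu).
by rewrite !le_mass//; (exact: openT || exact: open0).
Qed.

Lemma mass_modular mu U V : open U -> open V ->
  mass mu (U `|` V) + mass mu (U `&` V) = mass mu U + mass mu V.
Proof.
move=> oU oV; apply: EFin_inj; rewrite !EFinD -!mass_EFin//; last 2 first.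
- exact: openI.
- exact: openU.
have mU := open_measurable_borel oU; have mV := open_measurable_borel oV.
rewrite -[in LHS](setDUK (@subsetUl _ U V)) setDUl setDv set0U.
rewrite measureU//; [|exact: measurableD|by rewrite setIDA setIC -setIDA setDv setI0].
rewrite -addeA; congr (_ + _)%E.
by rewrite [RHS](measureDI _ mV mU) (setIC V U).
Qed.

Lemma Cb_opp_subproof f : continuous (- sval f) /\ bounded_fun (- sval f).
Proof.
case: f => f [cf [M [Mr Mf]]] /=; split.
  by move=> x; apply: cvgN; exact: cf.
by exists M; split => // x xM y _ /=; rewrite normrN; exact: Mf.
Qed.

Definition Cb_opp f : Cb R X := exist _ _ (Cb_opp_subproof f).

Lemma integrals_opp mu f : integrals mu (Cb_opp f) = - integrals mu f.
Proof.
rewrite -mulN1r; have <- := RintegralZl (-1) measurableT (Cb_integrable mu f).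
by apply: eq_Rintegral => x _; rewrite mulN1r.
Qed.

(** Through layer sums, lower bounds on masses of open sets become lower bounds on integrals; the
    upper bounds follow by passing to [- f]. *)
Lemma portmanteau (F : set_system (borel_prob R X)) mu : Filter F ->
  (forall U e, open U -> 0 < e -> F [set nu | mass mu U - e <= mass nu U]) ->
  F --> mu.
Proof.
move=> FF FU; apply: cvg_borel_prob => f.
have low g e : 0 < e -> F [set nu | integrals mu g - e <= integrals nu g].
  move=> e0.
  have [M gM] : exists M, forall x, `|sval g x| <= M.
    case: (g) => h [ch [M [Mr Mh]]]; exists (M + 1) => x; apply: Mh => //.
    by rewrite ltrDl.
  have M0 : 0 <= M by apply: le_trans (gM point).
  pose eta := e / 2; have eta0 : 0 < eta by rewrite divr_gt0.
  pose n := (Num.truncn (M *+ 2 / eta)).+1.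
  have Mn : M *+ 2 <= eta *+ n.
    by rewrite -mulr_natr mulrC -ler_pdivrMr// ltW// truncnS_gt.
  pose U (i : nat) : set X := [set x | eta *+ i < sval g x + M].
  have oU i : open (U i).
    rewrite (_ : U i = [set x | eta *+ i - M < sval g x]); last first.
      by apply/seteqP; split => x /=; rewrite ltrBlDr.
    by apply: open_gt_continuous; case: (g) => ? [].
  (* The [n] errors of [n^-1], weighted by [eta], cost [eta = e / 2] in all; rounding costs the
     other half. *)
  have FUn : F [set nu | forall i : 'I_n, mass mu (U i) - n%:R^-1 <= mass nu (U i)].
    by apply: filter_forall => i; apply: FU => //; rewrite invr_gt0.
  apply: filterS FUn => nu /= nuU.
  have /andP[mu1 _] := layer_sum_bounds mu eta0 gM Mn.
  have /andP[_ nu2] := layer_sum_bounds nu eta0 gM Mn.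
  rewrite -/(integrals mu g) in mu1; rewrite -/(integrals nu g) in nu2.
  have : eta * \sum_(i < n) (mass mu (U i) - n%:R^-1) <= eta * \sum_(i < n) mass nu (U i).
    by rewrite ler_pM2l//; apply: ler_sum.
  have nn : (- n%:R^-1) *+ n = -1 :> R by rewrite -[LHS]mulr_natr mulNr mulVf // pnatr_eq0.
  rewrite big_split/= sumr_const card_ord nn mulrDr => le1.
  move: mu1 nu2 le1; rewrite /mass/= /U /eta; lra.
apply/cvgrPdist_le => e e0.
have F1 := low f _ e0; have F2 := low (Cb_opp f) _ e0.
apply: filterS2 F1 F2 => nu /=; rewrite !integrals_opp ler_norml => ? ?.
by apply/andP; split; lra.
Qed.

End portmanteau.

(** * Elementary facts on metrics *)

Section metric_facts.
Variables (R : realType) (X : topologicalType) (d : X -> X -> R).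
Hypothesis dm : is_metric d.
Hypothesis dX : metrizes d.

Lemma metric_ge0 x y : 0 <= d x y.
Proof.
case: dm => d0 _ ds dt; have := dt y x x; rewrite d0 (ds y x); lra.
Qed.

Lemma nbhs_metric x (U : set X) :
  nbhs x U <-> exists2 e, 0 < e & forall y, d x y < e -> U y.
Proof. by rewrite dX; split=> -[e e0 eU]; exists e. Qed.

Lemma metric_continuous a : continuous (d a).
Proof.
case: dm => d0 _ ds dt x; apply/cvgrPdist_lt => e e0.
apply/nbhs_metric; exists e => //= y dxy.
rewrite ltr_norml; have := dt x a y; have := dt y a x; rewrite (ds y x) => ? ?.
by apply/andP; split; lra.
Qed.

End metric_facts.

(** * Countably many test functions built from bumps *)

Section test_functions.
Variables (R : realType) (X : ptopologicalType) (d : X -> X -> R) (q : nat -> X).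
Hypothesis dm : is_metric d.
Hypothesis dX : metrizes d.
Implicit Types (p : nat * nat) (l : seq (nat * nat)) (mu nu : borel_prob R X).

(** A plateau function: 1 on the closed ball of radius [2 ^- p.2] around [q p.1], and 0 outside the
    open ball of twice that radius. *)
Definition bump p (x : X) : R :=
  Num.max 0 (Num.min 1 (2 - 2 ^+ p.2 * d (q p.1) x)).

Definition bumps l (x : X) : R := foldr (fun p => Num.max (bump p x)) 0 l.

Lemma bump_continuous p : continuous (bump p).
Proof.
move=> x; apply: (@continuous_max _ _ (cst 0) _ x); first exact: cvg_cst.
apply: (@continuous_min _ _ (cst 1) _ x); first exact: cvg_cst.
apply: cvgB; first exact: cvg_cst.
by apply: cvgM; [exact: cvg_cst|exact: metric_continuous].
Qed.

Lemma bumps_continuous l : continuous (bumps l).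
Proof.
elim: l => [|p l IH] x; first exact: cvg_cst.
by apply: (@continuous_max _ _ (bump p) (bumps l) x); [exact: bump_continuous|exact: IH].
Qed.

Lemma bumps_ge0 l x : 0 <= bumps l x.
Proof. by elim: l => //= p l IH; rewrite le_max IH orbT. Qed.

Lemma bumps_le1 l x : bumps l x <= 1.
Proof.
elim: l => [|p l IH] /=; first exact: ler01.
by rewrite ge_max IH andbT /bump ge_max ler01/= ge_min lexx.
Qed.

Lemma bumps_gt0 l x : 0 < bumps l x ->
  exists2 p, p \in l & d (q p.1) x < 2 * 2 ^- p.2.
Proof.
elim: l => [|p l IH] /=; first by rewrite ltxx.
rewrite lt_max => /orP[|/IH[p' p'l dp]]; last by exists p'; rewrite // inE p'l orbT.
rewrite /bump lt_max ltxx/= lt_min ltr01/= subr_gt0 => h.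
by exists p; rewrite ?mem_head// ltr_pdivlMr ?exprn_gt0// mulrC.
Qed.

Lemma bumps_eq1 l p x : p \in l -> d (q p.1) x <= 2 ^- p.2 -> bumps l x = 1.
Proof.
move=> pl dp; apply/eqP; rewrite eq_le bumps_le1/=.
elim: l pl => //= p' l IH; rewrite inE => /orP[/eqP<-|/IH h]; last by rewrite le_max h orbT.
rewrite /bump !le_max le_min lexx/=; apply/orP; left; apply/orP; right.
move: dp; rewrite -[_ ^-_]mul1r ler_pdivlMr ?exprn_gt0// mulrC; lra.
Qed.

Lemma testf_subproof l : continuous (bumps l) /\ bounded_fun (bumps l).
Proof.
split; first exact: bumps_continuous.
exists 1; split; first exact: real1.
move=> M M1 x _ /=; rewrite ger0_norm ?bumps_ge0//.
exact: le_trans (bumps_le1 _ _) (ltW M1).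
Qed.

Definition testf l : Cb R X := exist _ _ (testf_subproof l).

(** Finite lists that exhaust [P] as [n] grows. *)
Definition pairs_upto (P : pred (nat * nat)) n : seq (nat * nat) :=
  [seq p <- pmap unpickle (iota 0 n) | P p].

Lemma pairs_upto_pred P n p : p \in pairs_upto P n -> P p.
Proof. by rewrite mem_filter => /andP[]. Qed.

Lemma mem_pairs_upto (P : pred (nat * nat)) n p :
  P p -> (pickle p < n)%N -> p \in pairs_upto P n.
Proof.
move=> Pp pn; rewrite mem_filter Pp mem_pmap; apply/mapP.
by exists (pickle p); rewrite ?mem_iota// pickleK.
Qed.

(** [bumps l] vanishes outside the doubled balls, so it lies below the indicator of [U]. *)
Lemma integral_testf_le mu l (U : set X) : open U ->
  (forall p x, p \in l -> d (q p.1) x < 2 * 2 ^- p.2 -> U x) ->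
  integrals mu (testf l) <= mass mu U.
Proof.
move=> /open_measurable_borel mU lU; rewrite /integrals.
have -> : mass mu U = \int[mu]_x (\1_(U : set (borel X)) x).
  by rewrite /Rintegral integral_indic// setIT.
apply: le_Rintegral => //; [exact: Cb_integrable|exact: integrable_indic|].
move=> x _; rewrite indicE /=; have := bumps_ge0 l x; rewrite le_eqVlt => /orP[/eqP<-//|b0].
rewrite mem_set ?bumps_le1//.
by have [p pl] := bumps_gt0 b0; exact: lU.
Qed.

(** Continuity from below along [B n], the part of [U] covered by balls of code below [n], where the
    test function equals 1. *)
Lemma mass_le_testf mu (P : pred (nat * nat)) (U : set X) (e : R) : open U ->
  (forall x, U x -> exists2 p, P p & d (q p.1) x < 2 ^- p.2) -> 0 < e ->
  exists n, mass mu U - e <= integrals mu (testf (pairs_upto P n)).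
Proof.
move=> oU UP e0.
pose B n : set (borel X) := U `&`
  [set x | exists2 p, P p && (pickle p < n)%N & d (q p.1) x < 2 ^- p.2].
have oB n : open (B n : set X).
  apply: openI => //; rewrite (_ : mkset _ = \bigcup_(p in [set p | P p && (pickle p < n)%N])
    [set x | d (q p.1) x < 2 ^- p.2]); last first.
    by apply/seteqP; split => x [p ? ?]; exists p.
  apply: bigcup_open => p _.
  rewrite (_ : mkset _ = [set x | - 2 ^- p.2 < - d (q p.1) x]); last first.
    by apply/seteqP; split => x /=; rewrite ltrN2.
  by apply: open_gt_continuous => x; apply: cvgN; exact: metric_continuous.
have mB n : measurable (B n) by exact: open_measurable_borel.
have BU : \bigcup_n B n = U.
  apply/seteqP; split => [x [n _ []]//|x Ux]; have [p Pp dp] := UP x Ux.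
  by exists (pickle p).+1 => //; split => //; exists p => //; rewrite Pp ltnS leqnn.
have ndB : nondecreasing_seq B.
  move=> m n mn; apply/subsetPset => x [Ux [p /andP[Pp pm] dp]].
  by split=> //; exists p => //; rewrite Pp (leq_trans pm).
have muB : mass mu \o B @ \oo --> mass mu U.
  apply: fine_cvg; rewrite -mass_EFin// -[in X in _ --> X]BU.
  apply: nondecreasing_cvg_mu => //.
  by rewrite BU; exact: open_measurable_borel.
move/cvgrPdist_le : muB => /(_ _ e0)[n _ /(_ n (leqnn n))] /=.
rewrite ler_norml => /andP[_ muBn]; exists n.
apply: (@le_trans _ _ (mass mu (B n))); first by lra.
have -> : mass mu (B n) = \int[mu]_x (\1_(B n : set (borel X)) x).
  by rewrite /Rintegral integral_indic// setIT.
apply: le_Rintegral => //; [exact: integrable_indic|exact: Cb_integrable|].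
move=> x _; rewrite indicE /=; case: (boolP (x \in B n)) => [|_]; last exact: bumps_ge0.
rewrite inE => -[Ux [p /andP[Pp pn] dp]].
by rewrite (bumps_eq1 (mem_pairs_upto Pp pn) (ltW dp)).
Qed.

End test_functions.

(** * A countable neighbourhood base at each measure *)

Lemma expn2V_lt (R : realType) (e : R) : 0 < e -> exists m : nat, 2 ^- m < e.
Proof.
move=> e0; exists (Num.truncn e^-1).
rewrite -[ltRHS]invrK ltf_pV2 ?posrE ?invr_gt0 ?exprn_gt0//.
apply: lt_le_trans (truncnS_gt _) _.
by rewrite -natrX ler_nat ltn_expl.
Qed.

Section neighbourhood_base.
Variables (R : realType) (X : ptopologicalType) (d : X -> X -> R) (q : nat -> X).
Hypothesis dm : is_metric d.
Hypothesis dX : metrizes d.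
Hypothesis qd : forall x e, 0 < e -> exists i, d (q i) x < e.
Implicit Types mu nu : borel_prob R X.

(** A number that decodes to no list stands for the empty list, whose test function is zero. *)
Definition test_enum (j : nat) : Cb R X :=
  testf q dm dX (odflt [::] (unpickle j)).

(** The factor 2 leaves room for a box of tolerance [1 / n.+1] around approximate values of the
    integrals. *)
Definition weak_ball mu (n : nat) : set (borel_prob R X) :=
  [set nu | forall j, (j < n)%N ->
    `|integrals mu (test_enum j) - integrals nu (test_enum j)| < 2 / n.+1%:R].

Lemma weak_ball_nbhs mu n : nbhs mu (weak_ball mu n).
Proof.
suff : nbhs mu [set nu | forall j : 'I_n,
    `|integrals mu (test_enum j) - integrals nu (test_enum j)| < 2 / n.+1%:R].
  by apply: filterS => nu H j jn; exact: (H (Ordinal jn)).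
have FF : Filter (nbhs mu) by exact: nbhs_filter.
apply: (@filter_forall _ 'I_n (fun j => [set nu | `|integrals mu (test_enum j)
  - integrals nu (test_enum j)| < 2 / n.+1%:R]) _ FF) => j.
have /cvgrPdist_lt := @integrals_continuous R X (test_enum j) mu.
by apply; rewrite divr_gt0.
Qed.

Lemma subset_weak_ball mu m n : (m <= n)%N -> weak_ball mu n `<=` weak_ball mu m.
Proof.
move=> mn nu H j jm; apply: lt_le_trans (H j (leq_trans jm mn)) _.
by rewrite ler_pM2l// lef_pV2 ?posrE// ler_nat ltnS.
Qed.

(** By the portmanteau criterion it is enough to bound masses of open [U] from below. A test
    function below the indicator of [U] whose integral nearly reaches [mass mu U] does this. *)
Lemma weak_ball_base mu (O : set (borel_prob R X)) :
  nbhs mu O -> exists n, weak_ball mu n `<=` O.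
Proof.
move=> muO; pose F := filter_from [set: nat] (weak_ball mu).
have FF : Filter F.
  apply: filter_fromT_filter; first by exists 0%N.
  move=> i j; exists (maxn i j) => nu H.
  by split; apply: subset_weak_ball H; rewrite ?leq_maxl ?leq_maxr.
suff /(_ _ muO)[n _ nO] : F --> mu by exists n.
apply: portmanteau => U e oU e0.
pose P (p : nat * nat) := `[< forall x, d (q p.1) x < 2 * 2 ^- p.2 -> U x >].
have e20 : 0 < e / 2 by rewrite divr_gt0.
have [|n Un] := @mass_le_testf _ _ d q dm dX mu P U _ oU _ e20.
  move=> x Ux; have [r r0 rU] : exists2 r, 0 < r & forall y, d x y < r -> U y.
    by apply/(nbhs_metric dX); exact: open_nbhs_nbhs.
  (* A centre within [2 ^- m] of [x] has its doubled ball within [3 * 2 ^- m < r] of [x]. *)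
  have [m mr] : exists m : nat, 2 ^- m < r / 3 by apply: expn2V_lt; rewrite divr_gt0.
  have [i ix] : exists i, d (q i) x < 2 ^- m by apply: qd; rewrite invr_gt0 exprn_gt0.
  exists (i, m) => //; apply/asboolP => y /= iy; apply: rU.
  case: dm => _ _ ds dt; have := dt (q i) x y; rewrite (ds x (q i)); lra.
pose l := pairs_upto P n.
(* The first bound puts the test function among those compared, the second makes the radius at most
   [e / 2]. *)
pose k := maxn (pickle l).+1 (Num.truncn (4 / e)).
exists k => // nu /(_ (pickle l)); rewrite leq_max leqnn => /(_ isT).
rewrite /test_enum pickleK/= ltr_norml => /andP[_ nul].
have lU : integrals nu (testf q dm dX l) <= mass nu U.
  apply: integral_testf_le => // p x /pairs_upto_pred/asboolP; exact.
have ke : 2 / k.+1%:R <= e / 2.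
  rewrite ler_pdivrMr// mulrAC ler_pdivlMr// (_ : 2 * 2 = 4)%R; last by lra.
  rewrite -ler_pdivrMl// mulrC; apply: le_trans (ltW (truncnS_gt _)) _.
  by rewrite ler_nat ltnS leq_maxr.
move: (lt_le_trans nul ke) Un lU; rewrite -/l /=.
move: (integrals mu _) (integrals nu _) => a b; lra.
Qed.

End neighbourhood_base.

(** * From a tight content on open sets to a Borel probability measure *)

Lemma ultra_mem_seq (T : Type) (I : eqType) (V : set_system T) (A : I -> set T)
    (l : seq I) : UltraFilter V ->
  V [set t | exists2 i, i \in l & A i t] -> exists2 i, i \in l & V (A i).
Proof.
move=> UV; elim: l => [|i l IH] Vl.
  have V0 : V set0 by apply: filterS Vl => t [].
  by have [] := @filter_not_empty _ V (@ultra_proper _ V UV) V0.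
have [VAi|VnAi] := in_ultra_setVsetC (A i) UV; first by exists i; rewrite ?mem_head.
have /IH[j jl VAj] : V [set t | exists2 j, j \in l & A j t].
  apply: filterS2 Vl VnAi => t [j + Ajt nAi].
  by rewrite inE => /orP[/eqP ji|jl]; [rewrite ji in Ajt|exists j].
by exists j => //; rewrite inE jl orbT.
Qed.

Lemma open_bigsetU (X : topologicalType) (U : nat -> set X) n :
  (forall i, open (U i)) -> open (\big[setU/set0]_(i < n) U i).
Proof.
move=> oU; elim/big_ind: _ => [|A B oA oB|i _]; [exact: open0|exact: openU|exact: oU].
Qed.

Section open_content.
Variables (R : realType) (X : ptopologicalType) (d : X -> X -> R) (q : nat -> X).
Hypothesis dm : is_metric d.
Hypothesis dX : metrizes d.
Hypothesis dc : complete_metric d.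
Hypothesis qd : forall x e, 0 < e -> exists i, d (q i) x < e.
(** [m] stands for a limit of masses along an ultrafilter. Such a limit stays modular on open sets
    but need not be continuous along increasing unions. *)
Variable m : set X -> R.
Hypothesis m0 : m set0 = 0.
Hypothesis mT : m setT = 1.
Hypothesis m_le : forall U V, open U -> open V -> U `<=` V -> m U <= m V.
Hypothesis m_modular : forall U V, open U -> open V ->
  m (U `|` V) + m (U `&` V) = m U + m V.
Hypothesis m_tight : forall k : nat, exists l : seq nat, exists S : set X,
  [/\ open S, 1 - 2 ^- k <= m S &
      forall x, S x -> exists2 i, i \in l & d (q i) x < 2 * 2 ^- k].

Lemma content_ge0 U : open U -> 0 <= m U.
Proof. by move=> oU; rewrite -m0; apply: m_le => //; exact: open0. Qed.

Lemma content_bigsetU (U : nat -> set X) n : (forall i, open (U i)) ->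
  m (\big[setU/set0]_(i < n) U i) <= \sum_(i < n) m (U i).
Proof.
move=> oU; elim: n => [|n IH]; first by rewrite !big_ord0 m0.
rewrite !big_ord_recr/=.
have oB : open (\big[setU/set0]_(i < n) U i) by exact: open_bigsetU.
have := m_modular oB (oU n); have := content_ge0 (openI oB (oU n)); lra.
Qed.

(* If no finite union were large, there would be points outside the first [j] sets
   that are covered by finitely many balls at each of the first [j] scales; along
   an ultrafilter they converge, to a point that no [U i] can contain. *)
Lemma open_cover_content (U : nat -> set X) (M : nat) : (forall i, open (U i)) ->
  (forall x, exists i, U i x) ->
  exists n, 1 - 2 ^- M <= m (\big[setU/set0]_(i < n) U i).
Proof.
move=> oU cU; apply: contrapT => /forallNP Hn.
have {}Hn n : m (\big[setU/set0]_(i < n) U i) < 1 - 2 ^- M.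
  by rewrite ltNge; apply/negP; exact: Hn.
have [/= l /choice[S HS]] := choice m_tight.
pose Z j := \big[setI/setT]_(i < j) S (M + i).+1.
have oZ j : open (Z j).
  rewrite /Z; elim/big_ind: _ => //; [exact: openT|exact: openI|].
  by move=> i _; have [] := HS (M + i).+1.
(* The losses [2 ^- (M + i).+1] form a geometric series with sum [2 ^- M], so [Z j] is larger than
   any of the unions and contains a point outside the [j]-th one. *)
have mZ j : 1 - 2 ^- M + 2 ^- (M + j) <= m (Z j).
  elim: j => [|j IH]; first by rewrite addn0 /Z big_ord0 mT; lra.
  have [oS mS _] := HS (M + j).+1.
  rewrite (_ : Z j.+1 = Z j `&` S (M + j).+1); last by rewrite /Z big_ord_recr.
  have := m_modular (oZ j) oS.
  have := m_le (openU (oZ j) oS) openT (@subsetT _ _); rewrite mT.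
  have -> : 2 ^- (M + j.+1) = 2 ^- (M + j).+1 :> R by rewrite addnS.
  have : 2 ^- (M + j) = 2 ^- (M + j).+1 + 2 ^- (M + j).+1 :> R.
    by rewrite [in RHS]exprS invfM; lra.
  lra.
have /choice[x xP] j : exists x, Z j x /\ ~ (\big[setU/set0]_(i < j) U i) x.
  apply: contrapT => /forallNP H.
  have : Z j `<=` \big[setU/set0]_(i < j) U i.
    by move=> y Zy; apply: contrapT => nU; apply: (H y).
  move=> /(m_le (oZ j) (open_bigsetU j oU)).
  have := mZ j; have := Hn j.
  have : 0 < 2 ^- (M + j) :> R by rewrite invr_gt0 exprn_gt0.
  lra.
have [V [UV ooV]] := ultraFilterLemma (eventually_filter : ProperFilter \oo).
have VS j : V [set n | S (M + j).+1 (x n)].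
  apply: ooV; exists j.+1 => // n /= jn; have [+ _] := xP n.
  by rewrite /Z (bigD1 (Ordinal jn))//= => -[].
(* One of the finitely many balls of each scale belongs to the ultrafilter. *)
have /choice[c cP] j : exists i, V [set n | d (q i) (x n) < 2 * 2 ^- (M + j).+1].
  have [|i _ Vi] := @ultra_mem_seq _ _ V
    (fun i => [set n | d (q i) (x n) < 2 * 2 ^- (M + j).+1]) (l (M + j).+1) UV.
    by apply: filterS (VS j) => n; have [_ _ H] := HS (M + j).+1; exact: H.
  by exists i.
have small j : (2 * 2 ^- (M + j).+1 : R) <= 2 ^- j.
  rewrite exprS invfM mulrA divff// mul1r lef_pV2 ?posrE ?exprn_gt0//.
  by rewrite ler_eXn2l ?ltr1n// leq_addl.
have [d0 _ ds dt] := dm.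
(* Any two selected balls share some [x n], so their centres form a Cauchy sequence. *)
have [y cy] : exists y : X, (fun j => q (c j)) @ \oo --> y.
  apply: dc => e e0; have [N Ne] : exists N : nat, 2 ^- N < e / 2.
    by apply: expn2V_lt; rewrite divr_gt0.
  exists N => i j Ni Nj.
  have [n [/= ni nj]] := filter_ex (filterI (cP i) (cP j)).
  have le k : (N <= k)%N -> (2 ^- k : R) <= 2 ^- N.
    by move=> Nk; rewrite lef_pV2 ?posrE ?exprn_gt0// ler_eXn2l ?ltr1n.
  have := dt (x n) (q (c i)) (q (c j)); rewrite (ds (x n)).
  have := small i; have := small j; have := le i Ni; have := le j Nj; lra.
have [i0 Uy] := cU y.
have [r r0 rU] : exists2 r, 0 < r & forall z, d y z < r -> U i0 z.
  by apply/(nbhs_metric dX); exact: open_nbhs_nbhs.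
have [N Nr] : exists N : nat, 2 ^- N < r / 2 by apply: expn2V_lt; rewrite divr_gt0.
have /cy[N' _ N'P] : nbhs y [set z | d y z < r / 2].
  by apply/(nbhs_metric dX); exists (r / 2) => //; rewrite divr_gt0.
pose j := maxn N N'.
have Vr : V [set n | U i0 (x n)].
  apply: filterS (cP j) => n /= nj; apply: rU.
  have := dt (q (c j)) y (x n); have := N'P j (leq_maxr _ _); have := small j.
  have : (2 ^- j : R) <= 2 ^- N.
    by rewrite lef_pV2 ?posrE ?exprn_gt0// ler_eXn2l ?ltr1n// leq_maxl.
  rewrite /=; lra.
have Vi0 : V [set n | (i0 < n)%N] by apply: ooV; exists i0.+1.
have [n [/= Un i0n]] := filter_ex (filterI Vr Vi0).
have [_ []] := xP n.
by rewrite -bigcup_mkord; exists i0.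
Qed.

(* The value [+oo] makes [mu_ext], which takes covers by measurable sets, range
   in effect over covers by open sets. *)
Definition open_cost (A : set (borel X)) : \bar R :=
  if `[< open (A : set X) >] then (m A)%:E else +oo%E.

Lemma open_costE U : open U -> open_cost U = (m U)%:E.
Proof. by move=> oU; rewrite /open_cost asboolT. Qed.

Lemma open_cost0 : open_cost set0 = 0%E.
Proof. by rewrite open_costE ?m0//; exact: open0. Qed.

Lemma open_cost_ge0 A : (0 <= open_cost A)%E.
Proof. by rewrite /open_cost; case: asboolP => // /content_ge0; rewrite lee_fin. Qed.

Definition content_outer : set (borel X) -> \bar R := mu_ext open_cost.

HB.instance Definition _ := isOuterMeasure.Build R (borel X) content_outer
  (mu_ext0 open_cost0 open_cost_ge0) (mu_ext_ge0 open_cost_ge0)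
  (@le_mu_ext _ _ _ open_cost) (mu_ext_sigma_subadditive open_cost_ge0).

Local Open Scope ereal_scope.

Lemma content_outer_le_cover (A : set X) (F : nat -> set X) :
  (forall i, open (F i)) -> A `<=` \bigcup_i F i ->
  content_outer A <= \sum_(i <oo) (m (F i))%:E.
Proof.
move=> oF AF; apply: ereal_inf_lbound; exists F.
  by split=> // i; exact: open_measurable_borel.
by apply: eq_eseriesr => i _; rewrite open_costE.
Qed.

Lemma content_outer_ge (A : set X) (a : \bar R) :
  (forall F : nat -> set X, (forall i, open (F i)) -> A `<=` \bigcup_i F i ->
    a <= \sum_(i <oo) (m (F i))%:E) -> a <= content_outer A.
Proof.
move=> H; apply: le_ereal_inf_tmp => _ [F [_ AF] <-].
have [oF|] := pselect (forall i, open (F i : set X)).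
  apply: le_trans (H F oF AF) _; rewrite le_eqVlt; apply/orP; left; apply/eqP.
  by apply: eq_eseriesr => i _; rewrite open_costE.
move=> /existsNP[i noF]; rewrite (@eseries_pinfty _ _ _ i) ?leey//.
  by move=> n _; rewrite -ltNye (lt_le_trans _ (open_cost_ge0 _)).
by rewrite /open_cost asboolF.
Qed.

Lemma content_outer_open U : open U -> content_outer U <= (m U)%:E.
Proof.
move=> oU; pose F i := if i is 0%N then U else set0.
have oF i : open (F i) by case: i => //= n; exact: open0.
apply: le_trans (@content_outer_le_cover _ F _ _) _ => //.
  by move=> x Ux; exists 0%N.
rewrite nneseries_recl//; last by move=> k _; rewrite lee_fin content_ge0.
rewrite eseries_cond/= eseries0 ?adde0// => -[|]//= k _ _.
by rewrite m0.
Qed.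

(** Cutting an open cover of the union down to [U] and to [V] gives covers of the two parts with
    disjoint corresponding members, whose contents add up by modularity. *)
Lemma content_outer_separated (A B U V : set X) : open U -> open V ->
  U `&` V = set0 -> A `<=` U -> B `<=` V ->
  content_outer A + content_outer B <= content_outer (A `|` B).
Proof.
move=> oU oV UV AU BV; apply: content_outer_ge => F oF ABF.
have oFU i : open (F i `&` U) by exact: openI.
have oFV i : open (F i `&` V) by exact: openI.
have leA : content_outer A <= \sum_(i <oo) (m (F i `&` U))%:E.
  apply: content_outer_le_cover => // x Ax.
  by have [|i _ Fi] := ABF x; [left|exists i => //; split => //; exact: AU].
have leB : content_outer B <= \sum_(i <oo) (m (F i `&` V))%:E.
  apply: content_outer_le_cover => // x Bx.
  by have [|i _ Fi] := ABF x; [right|exists i => //; split => //; exact: BV].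
apply: le_trans (leeD leA leB) _; rewrite -nneseriesD//; last 2 first.
- by move=> i _ _; rewrite lee_fin content_ge0.
- by move=> i _ _; rewrite lee_fin content_ge0.
apply: lee_nneseries => [i _ _|i _].
  by rewrite -EFinD lee_fin addr_ge0// content_ge0.
rewrite -EFinD lee_fin -m_modular// setIACA UV setI0 m0 addr0.
by apply: m_le => //; [exact: openU|move=> x [[]|[]]].
Qed.

(** Any countable open cover has finite unions of content arbitrarily close to 1, so no mass is
    lost. *)
Lemma content_outer_setT : content_outer setT = 1.
Proof.
apply/eqP; rewrite eq_le; apply/andP; split.
  by apply: le_trans (content_outer_open openT) _; rewrite mT.
apply: content_outer_ge => F oF cF; apply/lee_addgt0Pr => e e0.
have [M Me] := expn2V_lt e0.
have [|n nM] := open_cover_content M oF.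
  by move=> x; have [i _ Fi] := cF x I; exists i.
rewrite -leeBlDr//; apply: (@le_trans _ _ (\sum_(i < n) (m (F i))%:E)).
  rewrite sumEFin -EFinB lee_fin; apply: le_trans (content_bigsetU n oF).
  by apply: le_trans nM; lra.
rewrite -(big_mkord xpredT (fun i => (m (F i))%:E)).
by apply: nneseries_lim_ge => i _; rewrite lee_fin content_ge0.
Qed.

Lemma content_outer_le1 A : content_outer A <= 1.
Proof. by rewrite -content_outer_setT; exact: le_outer_measure. Qed.

(* The layers [L k] and [L k.+2] are separated, so the outer measures of the layers
   are summable and [w k] tends to the outer measure of [E `&` U]. *)
Lemma caratheodory_pos (g : X -> R) : continuous g ->
  content_outer.-caratheodory [set x | (0 < g x)%R].
Proof.
move=> cg; apply: le_caratheodory_measurable => E; set U := [set x | _].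
pose t (k : nat) : R := k.+1%:R^-1%R.
have t0 k : (0 < t k)%R by rewrite invr_gt0.
have tS k : (t k.+1 < t k)%R by rewrite ltf_pV2 ?posrE// ltr_nat.
have tle i j : (i <= j)%N -> (t j <= t i)%R.
  by move=> ij; rewrite lef_pV2 ?posrE// ler_nat ltnS.
pose Up k := [set x | (t k < g x)%R].
pose L k := [set x | (t k.+1 < g x <= t k)%R].
have sep k (A B : set X) : A `<=` Up k -> B `<=` [set x | (g x < t k)%R] ->
    content_outer A + content_outer B <= content_outer (A `|` B).
  move=> AU BV; apply: (@content_outer_separated _ _ (Up k) [set x | (g x < t k)%R]) => //.
  - exact: open_gt_continuous.
  - rewrite (_ : mkset _ = [set x | (- t k < - g x)%R]); last first.
      by apply/seteqP; split => x /=; rewrite ltrN2.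
    by apply: open_gt_continuous => x; apply: cvgN; exact: cg.
  - by apply/seteqP; split => x //= [/=]; rewrite /Up/=; lra.
pose a k := content_outer (E `&` L k).
pose w k := content_outer (E `&` Up k).
have a0 k : 0 <= a k by exact: outer_measure_ge0.
have wa k : w k + a k.+1 <= w k.+2.
  apply: le_trans (sep k _ _ _ _) _.
  - by move=> x [].
  - by move=> x [_ /= /andP[_ gk]]; apply: le_lt_trans gk (tS k).
  - apply: le_outer_measure => x [[Ex]|[Ex]]; rewrite /Up /L /=.
      by move=> gx; split => //; apply: lt_trans gx; apply: lt_trans (tS k).
    by move=> /andP[gx _].
(* Layers of the same parity are separated; the two consecutive terms of [w] bound the two
   parities. *)
have sw n : \sum_(i < n.+1) a i <= w n.+1 + w n.
  elim: n => [|n IH].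
    rewrite big_ord_recr big_ord0/= add0e; apply: (@le_trans _ _ (w 1%N)).
      by apply: le_outer_measure => x [Ex /andP[]].
    by rewrite leeDl// outer_measure_ge0.
  rewrite big_ord_recr/=; apply: le_trans (leeD2r _ IH) _.
  by rewrite -addeA addeC leeD2r.
have sa : \sum_(i <oo) a i < +oo.
  apply: (@le_lt_trans _ _ (1 + 1)); last by rewrite -EFinD ltry.
  apply: lime_le; first exact: is_cvg_nneseries.
  apply: nearW => n; rewrite big_mkord.
  apply: (@le_trans _ _ (\sum_(i < n.+1) a i)).
    by rewrite big_ord_recr/= leeDl.
  by apply: le_trans (sw n) _; apply: leeD; exact: content_outer_le1.
have tail : \sum_(N <= k <oo) a k @[N --> \oo] --> 0 by exact: nneseries_tail_cvg.
(* Only [Up k] is separated from the complement of [U]; the rest of [U] is paid for by the tail of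
   the layers. *)
have main k : content_outer (E `&` U) + content_outer (E `&` ~` U)
    <= content_outer E + \sum_(k <= i <oo) a i.
  have EU : content_outer (E `&` U) <= w k + \sum_(k <= i <oo) a i.
    apply: (@le_trans _ _ (content_outer ((E `&` Up k) `|`
        \bigcup_(i in ~` `I_k) (E `&` L i)))); last first.
      apply: le_trans (outer_measureU2 _ _ _) _; apply: leeD => //.
      exact: outer_measure_sigma_subadditive_tail.
    apply: le_outer_measure => x [Ex /= gx].
    have [gk|gk] := ltP (t k) (g x); [by left|right].
    have exN : exists n, (t n < g x)%R.
      exists (Num.truncn (g x)^-1%R).
      by rewrite /t -[ltRHS]invrK ltf_pV2 ?posrE ?invr_gt0// truncnS_gt.
    (* This [n] exceeds [k], and its predecessor is the index of the layer containing [x]. *)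
    pose n := ex_minn exN.
    have [tn nmin] : (t n < g x)%R /\ forall i, (t i < g x)%R -> (n <= i)%N.
      by rewrite /n; case: ex_minnP.
    have kn : (k < n)%N.
      by rewrite ltnNge; apply/negP => /tle; move: tn gk; lra.
    case: n => // n in tn nmin kn *.
    exists n => /=; first by apply/negP; rewrite -leqNgt.
    split => //; rewrite /L/= tn/= leNgt; apply/negP => /nmin.
    by rewrite ltnn.
  apply: le_trans (leeD2r _ EU) _; rewrite addeAC; apply: leeD => //.
  apply: le_trans (sep k _ _ _ _) _.
  - by move=> x [].
  - by move=> x [_ /= /negP]; rewrite -leNgt => gx; apply: le_lt_trans gx (t0 k).
  - by apply: le_outer_measure => x [[]|[]].
apply/lee_addgt0Pr => e e0.
have /fine_cvgP[finN /cvgrPdist_le/(_ _ e0) tailN] := tail.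
have [N [/= N1 N2]] := filter_ex (filterI finN tailN).
apply: le_trans (main N) _; apply: leeD => //.
rewrite -[leLHS]fineK// lee_fin; move: N2; rewrite sub0r normrN.
exact/le_trans/ler_norm.
Qed.

(** Balls are positivity sets of continuous functions, and every open set is a countable union of
    balls with centres [q i] and radii [2 ^- k]. *)
Lemma caratheodory_borel (A : set (borel X)) :
  measurable A -> content_outer.-caratheodory A.
Proof.
apply: smallest_sub.
  split.
  - exact: caratheodory_measurable_set0.
  - by move=> B mB; rewrite setTD; exact: caratheodory_measurable_setC.
  - exact: caratheodory_measurable_bigcup.
move=> U oU.
pose ball (p : nat * nat) := [set x | (0 < 2 ^- p.2 - d (q p.1) x)%R].
pose B n : set X :=
  if unpickle n is Some p then if `[< ball p `<=` U >] then ball p else set0 else set0.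
have -> : U = \bigcup_n B n.
  apply/seteqP; split => [x Ux|x [n _]]; last first.
    by rewrite /B; case: unpickle => // p; case: asboolP => // + ; exact.
  have [r r0 rU] : exists2 r, (0 < r)%R & forall y, (d x y < r)%R -> U y.
    by apply/(nbhs_metric dX); exact: open_nbhs_nbhs.
  have [k kr] : exists k : nat, (2 ^- k < r / 2)%R by apply: expn2V_lt; rewrite divr_gt0.
  have [i ix] : exists i, (d (q i) x < 2 ^- k)%R by apply: qd; rewrite invr_gt0 exprn_gt0.
  exists (pickle (i, k)) => //; rewrite /B pickleK asboolT; first by rewrite /ball/= subr_gt0.
  move=> y; rewrite /ball/= subr_gt0 => iy; apply: rU.
  case: dm => _ _ ds dt; have := dt (q i) x y; rewrite (ds x (q i)); lra.
apply: caratheodory_measurable_bigcup => n; rewrite /B.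
case: unpickle => [p|]; last exact: caratheodory_measurable_set0.
case: asboolP => _; last exact: caratheodory_measurable_set0.
apply: caratheodory_pos => x; apply: cvgB; first exact: cvg_cst.
exact: metric_continuous.
Qed.

Lemma content_outer_sigma_additive : semi_sigma_additive content_outer.
Proof.
move=> F mF tF mUF.
apply: (@caratheodory_measure_sigma_additive R _ content_outer) => //.
  by move=> i; exact: caratheodory_borel.
exact: caratheodory_borel.
Qed.

HB.instance Definition _ := isMeasure.Build _ _ _ content_outer
  (outer_measure0 content_outer) (outer_measure_ge0 content_outer)
  content_outer_sigma_additive.

HB.instance Definition _ :=
  Measure_isProbability.Build _ _ _ content_outer content_outer_setT.

(** The inequality has the direction that the portmanteau criterion asks for: limit masses of open
    sets are at least those of [mu]. *)
Lemma content_dominates_probability :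
  exists mu : borel_prob R X, forall U, open U -> (mass mu U <= m U)%R.
Proof.
exists (content_outer : probability (borel X) R) => U oU.
by rewrite -lee_fin -mass_EFin//; exact: content_outer_open.
Qed.

End open_content.

(** * Limits of tight sequences along ultrafilters *)

Lemma ultra_cvg_unit (R : realType) (T : Type) (G : set_system T) (u : T -> R) :
  UltraFilter G -> (forall t, 0 <= u t <= 1) -> cvg (u @ G).
Proof.
move=> UG u01.
have [|p [_ clp]] := @segment_compact R 0 1 (u @ G) _.
  by apply: nearW => t /=; rewrite in_itv/= u01.
apply/cvg_ex; exists p => A pA /=.
(* An ultrafilter converges to each of its cluster points. *)
have [//|GnA] := in_ultra_setVsetC (u @^-1` A) UG.
have [y [nAy Ay]] : (~` A) `&` A !=set0 by apply: clp.
by [].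
Qed.

Section prokhorov.
Variables (R : realType) (X : ptopologicalType) (d : X -> X -> R) (q : nat -> X).
Hypothesis dm : is_metric d.
Hypothesis dX : metrizes d.
Hypothesis dc : complete_metric d.
Hypothesis qd : forall x e, 0 < e -> exists i, d (q i) x < e.

Definition scale_pairs (k n : nat) := pairs_upto (fun p => p.2 == k) n.

(** The limits along [G] of the masses of open sets form a tight content; a probability measure
    dominated by it is the limit by the portmanteau criterion. *)
Lemma prokhorov (nu : nat -> borel_prob R X) (G : set_system nat) :
  UltraFilter G ->
  (forall k : nat, exists n, G [set j |
     1 - 2 ^- k <= integrals (nu j) (testf q dm dX (scale_pairs k n))]) ->
  exists mu : borel_prob R X, nu @ G --> mu.
Proof.
move=> UG tight; pose m (U : set X) : R := lim (mass (nu j) U @[j --> G]).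
have mcvg U : open U -> mass (nu j) U @[j --> G] --> m U.
  by move=> oU; apply: ultra_cvg_unit => j; exact: mass_unit.
have mcst U c : (forall j, mass (nu j) U = c) -> m U = c.
  move=> H; rewrite /m (_ : (fun j => _) = cst c); last exact/funext.
  exact: lim_cst.
have [mu muP] : exists mu : borel_prob R X, forall U, open U -> mass mu U <= m U.
  apply: (content_dominates_probability dm dX dc qd).
  - by apply: mcst => j; exact: mass0.
  - by apply: mcst => j; exact: massT.
  - move=> U V oU oV UV; apply: ler_lim; [exact: mcvg|exact: mcvg|].
    by apply: nearW => j; exact: le_mass.
  - move=> U V oU oV.
    have c1 := cvgD (mcvg _ (openU oU oV)) (mcvg _ (openI oU oV)).
    have c2 := cvgD (mcvg _ oU) (mcvg _ oV).
    rewrite -(cvg_lim _ (c1 _))// -(cvg_lim _ (c2 _))//.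
    by congr (lim (_ @ G)); apply/funext => j; exact: mass_modular.
  - move=> k; have [n Gn] := tight k.
    exists [seq p.1 | p <- scale_pairs k n].
    (* The doubled balls carry all of the test function, hence at least its integral in mass. *)
    pose S := \bigcup_(p in [set p | p \in scale_pairs k n])
      [set x | d (q p.1) x < 2 * 2 ^- p.2].
    have oS : open S.
      apply: bigcup_open => p _.
      rewrite (_ : mkset _ = [set x | - (2 * 2 ^- p.2) < - d (q p.1) x]); last first.
        by apply/seteqP; split => x /=; rewrite ltrN2.
      by apply: open_gt_continuous => x; apply: cvgN; exact: metric_continuous.
    exists S; split => //.
      apply: limr_ge; first exact: mcvg.
      apply: filterS Gn => j /le_trans; apply.
      by apply: integral_testf_le => // p x pl dp; exists p.
    move=> x [p /= pl dp]; exists p.1; first exact: map_f.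
    by have /eqP <- := pairs_upto_pred pl.
exists mu; apply: portmanteau => U e oU e0.
have /cvgrPdist_le/(_ _ e0) := mcvg U oU; apply: filterS => j /=.
rewrite ler_norml => /andP[_ h]; have := muP U oU; lra.
Qed.

End prokhorov.

(** * The topology of a metric on a bare type *)

Section metric_space.
Variables (R : realType) (T : Type) (D : T -> T -> R).

Definition metric_axioms :=
  [/\ forall x, D x x = 0,
      forall x y, D x y = 0 -> x = y,
      forall x y, D x y = D y x
    & forall y x z, D x z <= D x y + D y z].

(** An alias of [T] indexed by the proof of the axioms, to which the topological structure can be
    attached. *)
Definition metric_space (h : metric_axioms) : Type := T.

Variable h : metric_axioms.
Local Notation M := (metric_space h).

HB.instance Definition _ := gen_eqMixin M.
HB.instance Definition _ := gen_choiceMixin M.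

Definition metric_nbhs (x : M) : set_system M :=
  filter_from [set e : R | 0 < e] (fun e => [set y | D x y < e]).

HB.instance Definition _ := hasNbhs.Build M metric_nbhs.

Lemma metric_nbhs_filter (x : M) : ProperFilter (nbhs x).
Proof.
have [d0 _ _ _] := h; apply: filter_from_proper => [|e e0]; last first.
  by exists x; rewrite /= d0.
apply: filter_from_filter => [|i j i0 j0]; first by exists 1; exact: ltr01.
exists (Num.min i j); first by rewrite /= lt_min i0.
by move=> y /=; rewrite lt_min => /andP[].
Qed.

Lemma metric_nbhs_singleton (x : M) (A : set M) : nbhs x A -> A x.
Proof. by have [d0 _ _ _] := h; move=> [e e0 eA]; apply: eA; rewrite /= d0. Qed.

Lemma metric_nbhs_nbhs (x : M) (A : set M) : nbhs x A -> nbhs x (nbhs^~ A).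
Proof.
have [_ _ _ dt] := h; move=> [e /= e0 eA]; exists e => // y /= xy.
exists (e - D x y); first by rewrite /= subr_gt0.
by move=> z /= yz; apply: eA => /=; have := dt y x z; lra.
Qed.

HB.instance Definition _ := Nbhs_isNbhsTopological.Build M
  metric_nbhs_filter metric_nbhs_singleton metric_nbhs_nbhs.

End metric_space.

(** * The metric of the Baire space *)

Section baire_metric.
Variables (R : realType) (A : countType).
Implicit Types v w : nat -> A.

(** Being closer than [n.+1^-1] amounts to agreeing up to index [n] included. *)
Definition baire_dist v w : R :=
  if pselect (exists n, v n != w n) is left h then (ex_minn h).+1%:R^-1 else 0.

Lemma baire_dist_ge v w n : v n != w n -> n.+1%:R^-1 <= baire_dist v w.
Proof.
move=> vw; rewrite /baire_dist; case: pselect => [h|[]]; last by exists n.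
by case: ex_minnP => k _ /(_ _ vw) kn; rewrite lef_pV2 ?posrE// ler_nat ltnS.
Qed.

Lemma baire_dist_agree v w n i : baire_dist v w < n.+1%:R^-1 -> (i <= n)%N -> v i = w i.
Proof.
move=> vwn ni; apply/eqP; apply: contraLR vwn => /baire_dist_ge vi; rewrite -leNgt.
by apply: le_trans vi; rewrite lef_pV2 ?posrE// ler_nat ltnS.
Qed.

Lemma baire_dist_lt v w n : (forall i, (i <= n)%N -> v i = w i) ->
  baire_dist v w < n.+1%:R^-1.
Proof.
move=> vw; rewrite /baire_dist; case: pselect => [h|_]; last by rewrite invr_gt0.
case: ex_minnP => k vk _; rewrite ltf_pV2 ?posrE// ltr_nat ltnS ltnNge.
by apply: contra vk => /vw ->.
Qed.

Lemma baire_dist_ge0 v w : 0 <= baire_dist v w.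
Proof. by rewrite /baire_dist; case: pselect => // h; rewrite invr_ge0. Qed.

Lemma baire_distxx v : baire_dist v v = 0.
Proof. by rewrite /baire_dist; case: pselect => // h; have [n] := h; rewrite eqxx. Qed.

Lemma baire_dist_eq0 v w : baire_dist v w = 0 -> v = w.
Proof.
move=> vw; apply/funext => n; apply: (@baire_dist_agree _ _ n) => //.
by rewrite vw invr_gt0.
Qed.

Lemma baire_dist_sym v w : baire_dist v w = baire_dist w v.
Proof.
suff le a b : baire_dist a b <= baire_dist b a by apply/eqP; rewrite eq_le !le.
rewrite {1}/baire_dist; case: pselect => [h|_]; last exact: baire_dist_ge0.
by case: ex_minnP => k + _; rewrite eq_sym => /baire_dist_ge.
Qed.

(** At the first index where [v] and [u] differ, [w] differs from one of them. *)
Lemma baire_dist_triangle w v u : baire_dist v u <= baire_dist v w + baire_dist w u.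
Proof.
have vw0 := baire_dist_ge0 v w; have wu0 := baire_dist_ge0 w u.
rewrite {1}/baire_dist; case: pselect => [h|_]; last exact: addr_ge0.
case: ex_minnP => k vk _; have [vw|/baire_dist_ge vw] := eqVneq (v k) (w k).
  by move: vk; rewrite vw => /baire_dist_ge/le_trans; apply; rewrite lerDr.
by apply: le_trans vw _; rewrite lerDl.
Qed.

End baire_metric.

(** * The Souslin operation on closed sets yields analytic sets *)

Section souslin.
Variables (R : realType) (X : topologicalType) (d : X -> X -> R) (q : nat -> X).
Hypothesis dm : is_metric d.
Hypothesis dX : metrizes d.
Hypothesis dc : complete_metric d.
Hypothesis qd : forall x e, 0 < e -> exists i, d (q i) x < e.
Variables (A : countType) (C : nat -> (nat -> A) -> set X).
Hypothesis C_closed : forall k w, closed (C k w).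
Hypothesis C_local : forall k v w, (forall i, (i <= k)%N -> v i = w i) ->
  C k v `<=` C k w.

(** The incidence set of the Souslin scheme, Polish for the maximum metric; its projection to [X] is
    the result of the operation. *)
Let Y := {p : X * (nat -> A) | forall k, C k p.2 p.1}.

Let D (y z : Y) : R :=
  Num.max (d (sval y).1 (sval z).1) (baire_dist R (sval y).2 (sval z).2).

Let D_metric : metric_axioms D.
Proof.
case: dm => d0 d1 ds dt; split.
- by move=> y; rewrite /D d0 baire_distxx maxxx.
- move=> [[x v] xv] [[z w] zw]; rewrite /D/= => xz.
  have le1 : d x z <= 0 by rewrite -xz le_max lexx.
  have le2 : baire_dist R v w <= 0 by rewrite -xz le_max lexx orbT.
  apply: eq_exist => /=; congr pair.
    by apply: d1; apply/eqP; rewrite eq_le le1 metric_ge0.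
  by apply: (@baire_dist_eq0 R); apply/eqP; rewrite eq_le le2 baire_dist_ge0.
- by move=> y z; rewrite /D ds baire_dist_sym.
- move=> y x z; rewrite /D ge_max; apply/andP; split.
    apply: le_trans (dt (sval y).1 _ _) _.
    by apply: lerD; rewrite le_max lexx.
  apply: le_trans (baire_dist_triangle R (sval y).2 _ _) _.
  by apply: lerD; rewrite le_max lexx orbT.
Qed.

Let Z := metric_space D_metric.

Let Z_separable : separable Z.
Proof.
(* A triple [t] describes a point by a nearby [q i], a precision and an initial word. Choosing one
   point of [Y] for each description that is met gives a countable dense set. *)
pose good (t : nat * nat * seq A) (y : Z) :=
  d (q t.1.1) (sval y).1 < t.1.2.+1%:R^-1 /\
  mkseq (sval y).2 t.1.2.+1 = t.2.
have /choice[f fP] t : exists o : option Z,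
    if o is Some y then good t y else forall y, ~ good t y.
  have [[y gy]|/forallNP ng] := pselect (exists y, good t y).
    by exists (Some y).
  by exists None.
exists [set y | exists t, f t = Some y].
  apply/countable_injP.
  have /choice[g gP] y : exists t, (exists t, f t = Some y) -> f t = Some y.
    have [[t ft]|nf] := pselect (exists t, f t = Some y).
      by exists t.
    by exists (0%N, 0%N, [::]).
  exists (pickle \o g) => y z; rewrite !inE /= => /gP fy /gP fz.
  move=> /(pcan_inj pickleK) gyz; move: fy; rewrite gyz fz => -[].
  by [].
move=> O [y Oy] oO.
have [e /= e0 eO] : nbhs y O by exact: open_nbhs_nbhs.
pose k := Num.truncn (2 / e).
have ke : 2 * k.+1%:R^-1 < e.
  by rewrite ltr_pdivrMr// mulrC -ltr_pdivrMr// truncnS_gt.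
have k0 : 0 < k.+1%:R^-1 :> R by rewrite invr_gt0.
have [i iy] := qd (sval y).1 k0.
have := fP (i, k, mkseq (sval y).2 k.+1).
case ft : (f _) => [z|]; last by move=> /(_ y)[].
rewrite /good/= => -[iz sz].
exists z; split; last by exists (i, k, mkseq (sval y).2 k.+1).
apply: eO; rewrite /= /D gt_max; apply/andP; split.
  case: dm => _ _ ds dt; have := dt (q i) (sval y).1 (sval z).1.
  by rewrite (ds (sval y).1 (q i)); move: ke iy iz; set r := _^-1; lra.
apply: (@lt_trans _ _ k.+1%:R^-1); last by move: ke k0; set r := _^-1; lra.
apply: baire_dist_lt => j; rewrite -ltnS => jk.
by rewrite -(nth_mkseq ((sval y).2 0%N) (sval y).2 jk) -sz nth_mkseq.
Qed.

Let Z_complete : complete_metric (D : Z -> Z -> R).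
Proof.
move=> u cu.
have [x ux] : exists x : X, (fun n => (sval (u n)).1) @ \oo --> x.
  apply: dc => e /cu[N NP]; exists N => m n Nm Nn.
  by have := NP m n Nm Nn; rewrite /D gt_max => /andP[].
have /choice[N NP] n : exists N : nat, forall m m', (N <= m)%N -> (N <= m')%N ->
    forall i, (i <= n)%N -> (sval (u m)).2 i = (sval (u m')).2 i.
  have n0 : 0 < n.+1%:R^-1 :> R by rewrite invr_gt0.
  have [N NP] := cu _ n0; exists N => m m' Nm Nm' i.
  by apply: (@baire_dist_agree R); have := NP _ _ Nm Nm'; rewrite /D gt_max => /andP[].
(* From rank [N n] on, the entries up to index [n] no longer change; [w] collects these final
   values. *)
pose w n := (sval (u (N n))).2 n.
have uw n m i : (N n <= m)%N -> (i <= n)%N -> (sval (u m)).2 i = w i.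
  move=> Nm ni; rewrite (NP n m (maxn (N n) (N i)))// ?leq_maxl//.
  by rewrite (NP i (maxn (N n) (N i)) (N i))// leq_maxr.
(* By locality, late terms have their first coordinate in the closed set [C k w], hence so does the
   limit. *)
have xw k : C k w x.
  apply: (@closed_cvg _ _ \oo _ (fun n => (sval (u n)).1) (C k w)) => //.
  exists (N k) => // m /= Nm; apply: (@C_local k (sval (u m)).2).
    by move=> i ik; apply: uw ik.
  exact: (svalP (u m)).
exists (exist _ (x, w) xw : Z) => B [e /= e0 eB].
have /ux[N1 _ N1P] : nbhs x [set z | d x z < e] by rewrite dX; exists e.
pose k := Num.truncn e^-1.
have ke : k.+1%:R^-1 < e by rewrite -[ltRHS]invrK ltf_pV2 ?posrE ?invr_gt0// truncnS_gt.
exists (maxn N1 (N k)) => // m /=; rewrite geq_max => /andP[N1m Nm]; apply: eB.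
rewrite /= /D gt_max; apply/andP; split; first exact: N1P.
by apply: lt_trans ke; apply: baire_dist_lt => i ik /=; rewrite (uw k).
Qed.

Lemma souslin_analytic : analytic R [set x | exists w, forall k, C k w x].
Proof.
exists Z, (fun y => (sval y).1); split.
- split; first exact: Z_separable.
  by exists D; split; [exact: D_metric|move=> y|exact: Z_complete].
- move=> y B; rewrite /= dX => -[e e0 eB]; exists e => // z /=.
  by rewrite /D gt_max => /andP[xz _]; exact: eB.
- apply/seteqP; split => [_ [y _ <-]|x [w xw]].
    by exists (sval y).2; exact: svalP y.
  by exists (exist _ (x, w) xw).
Qed.

End souslin.

(** * Integrals against empirical measures are continuous in the point *)

Section empirical_integrals.
Variables (R : realType) (X : ptopologicalType) (T : X -> X).
Hypothesis cT : continuous T.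

(** For nonnegative functions the integral is additive in the measure; the test functions are of
    this kind. *)
Lemma integrals_empirical x n (f : Cb R X) : (forall y, 0 <= sval f y) ->
  integrals (empirical_prob R T x n) f =
  n.+1%:R^-1 * \sum_(j < n.+1) sval f (iter j T x).
Proof.
move=> f0; have mf : measurable_fun [set: borel X] (fun y : borel X => (sval f y)%:E).
  apply/measurable_EFinP; apply: (@continuous_measurable_borel R X (sval f)).
  by case: (f) => ? [].
have f0E (y : borel X) : setT y -> (0 <= (sval f y)%:E)%E by rewrite lee_fin.
rewrite /integrals /Rintegral /= /empirical ge0_integral_mscale//.
rewrite ge0_integral_measure_sum//.
rewrite (eq_bigr (fun j : 'I_n.+1 => (sval f (iter j T x))%:E)); last first.
  by move=> j _; rewrite integral_dirac// diracT mul1e.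
by rewrite sumEFin -EFinM.
Qed.

Lemma continuous_iter j : continuous (iter j T).
Proof.
elim: j => [|j IH] x; first exact: cvg_id.
by apply: continuous_comp; [exact: IH|exact: cT].
Qed.

Lemma continuous_integrals_empirical n (f : Cb R X) : (forall y, 0 <= sval f y) ->
  continuous (fun x => integrals (empirical_prob R T x n) f).
Proof.
move=> f0; rewrite (_ : (fun x => _) = fun x =>
    n.+1%:R^-1 * \sum_(j < n.+1) sval f (iter j T x)); last first.
  by apply/funext => x; exact: integrals_empirical.
have cS k : continuous (fun x => \sum_(j < k) sval f (iter j T x)).
  elim: k => [|k IH].
    rewrite (_ : (fun x => _) = cst 0); first by move=> x; exact: cvg_cst.
    by apply/funext => x; rewrite big_ord0.
  rewrite (_ : (fun x => _) = fun x =>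
    \sum_(j < k) sval f (iter j T x) + sval f (iter k T x)); last first.
    by apply/funext => x; rewrite big_ord_recr.
  move=> x; apply: cvgD; first exact: IH.
  apply: (@continuous_comp _ _ _ (iter k T) (sval f)); first exact: continuous_iter.
  by have [cg _] := svalP f; exact: cg.
by move=> x; apply: cvgM; [exact: cvg_cst|exact: cS].
Qed.

End empirical_integrals.

Lemma separable_dense_seq (R : realType) (X : ptopologicalType) (d : X -> X -> R) :
  is_metric d -> metrizes d -> separable X ->
  exists q : nat -> X, forall x e, 0 < e -> exists i, d (q i) x < e.
Proof.
move=> dm dX [D /countable_injP[f finj] dD].
have /choice[q qP] n : exists y : X, forall z, D z -> f z = n -> y = z.
  have [[z [Dz fz]]|H] := pselect (exists z, D z /\ f z = n).
    by exists z => z' Dz' fz'; apply: finj; rewrite ?inE// fz fz'.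
  (* Indices that code no point of [D] receive the default point. *)
  by exists point => z Dz fz; case: H; exists z.
exists q => x e e0.
have [] := dD [set y | - e < - d x y].
- by exists x; rewrite /= ltrN2; case: dm => ->.
- by apply: open_gt_continuous => y; apply: cvgN; exact: metric_continuous.
move=> y [/= + Dy]; rewrite ltrN2 => xy; exists (f y).
by rewrite (qP (f y) y)//; case: dm => _ _ -> _.
Qed.

(** * Coding the points outside [G_ T V] by closed conditions *)

Section fact19.
Variables (R : realType) (X : ptopologicalType) (T : X -> X).
Variable V : set (borel_prob R X).
Variables (d : X -> X -> R) (q : nat -> X).
Hypothesis cT : continuous T.
Hypothesis cV : closed V.
Hypothesis dm : is_metric d.
Hypothesis dX : metrizes d.
Hypothesis dc : complete_metric d.
Hypothesis qd : forall x e, 0 < e -> exists i, d (q i) x < e.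
Implicit Types (nu : borel_prob R X) (x : X).

Local Notation test := (test_enum q dm dX).
Local Notation tightf k n := (testf q dm dX (scale_pairs k n)).

(* In a witness [w], the box (number of test functions, scaled integer values) is
   that of [w 0], the third component of [w i] is the number of pairs that gives
   tightness at scale [2 ^- i], and the last one is the [i]-th time. *)
Definition code := (nat * seq int * nat * nat)%type.
Definition code_size (e : code) : nat := e.1.1.1.
Definition code_values (e : code) : seq int := e.1.1.2.
Definition code_tight (e : code) : nat := e.1.2.
Definition code_time (e : code) : nat := e.2.

(** Non-strict inequalities let limits of measures in the box remain in it. *)
Definition code_box (e : code) : set (borel_prob R X) :=
  [set nu | forall j, (j < code_size e)%N ->
    `|(nth 0 (code_values e) j)%:~R / (code_size e).+1%:R - integrals nu (test j)|
      <= 1 / (code_size e).+1%:R].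

(** Tightness at scale [i] is asked only of the times from index [i] on, so that the [k]-th
    condition reads no entry of [w] beyond [w k]. *)
Definition witness (k : nat) (w : nat -> code) : set X :=
  [set x | [/\ (0 < k)%N -> (code_time (w k.-1) < code_time (w k))%N,
    code_box (w 0%N) `&` V = set0,
    code_box (w 0%N) (empirical_prob R T x (code_time (w k))) &
    forall i, (i <= k)%N -> 1 - 2 ^- i <=
      integrals (empirical_prob R T x (code_time (w k))) (tightf i (code_tight (w i)))]].

Lemma testf_ge0 l y : 0 <= sval (testf q dm dX l) y.
Proof. exact: bumps_ge0. Qed.

Lemma witness_closed k w : closed (witness k w).
Proof.
have cst (P : Prop) : closed [set x : X | P].
  have [p|np] := pselect P.
    by rewrite (_ : mkset _ = setT); [exact: closedT|apply/seteqP; split].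
  by rewrite (_ : mkset _ = set0); [exact: closed0|apply/seteqP; split].
have -> : witness k w =
  [set x | (0 < k)%N -> (code_time (w k.-1) < code_time (w k))%N] `&`
  [set x | code_box (w 0%N) `&` V = set0] `&`
  \bigcap_(j in [set j | (j < code_size (w 0%N))%N])
     [set x | `|(nth 0 (code_values (w 0%N)) j)%:~R / (code_size (w 0%N)).+1%:R
        - integrals (empirical_prob R T x (code_time (w k))) (test j)|
      <= 1 / (code_size (w 0%N)).+1%:R] `&`
  \bigcap_(i in [set i | (i <= k)%N])
     [set x | 1 - 2 ^- i <=
      integrals (empirical_prob R T x (code_time (w k))) (tightf i (code_tight (w i)))].
  apply/seteqP; split => [x [? ? H3 H4]|x [[[? ?] H3] H4]].
    by split => //; split => // j; exact: H3.
  by split.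
apply: closedI; first apply: closedI; first by apply: closedI; exact: cst.
- apply: closed_bigI => j _; apply: closed_le_continuous.
  move=> x; apply: cvg_norm; apply: cvgB; first exact: cvg_cst.
  by apply: continuous_integrals_empirical => // y; exact: testf_ge0.
- apply: closed_bigI => i _.
  rewrite (_ : mkset _ = [set x | - integrals (empirical_prob R T x
      (code_time (w k))) (tightf i (code_tight (w i))) <= - (1 - 2 ^- i)]).
    apply: closed_le_continuous => x; apply: cvgN.
    by apply: continuous_integrals_empirical => // y; exact: testf_ge0.
  by apply/seteqP; split => x /=; rewrite lerN2.
Qed.

Lemma witness_local k v w : (forall i, (i <= k)%N -> v i = w i) ->
  witness k v `<=` witness k w.
Proof.
move=> vw x [H1 H2 H3 H4]; rewrite /witness/=.
rewrite -!vw ?leq_pred//; split => // i ik.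
by rewrite -!vw//; exact: H4.
Qed.

(** Tightness gives a limit [mu] along an ultrafilter. It stays in the box, hence outside [V], and
    the countable base at [mu] turns the ultrafilter limit into the limit of a subsequence. *)
Lemma witness_sound x w : (forall k, witness k w x) -> ~ G_ T V x.
Proof.
move=> H; pose s k := code_time (w k); pose nu k := empirical_prob R T x (s k).
have sS k : (s k < s k.+1)%N by have [+ _ _ _] := H k.+1; exact.
have [G [UG ooG]] := ultraFilterLemma (eventually_filter : ProperFilter \oo).
have [mu numu] : exists mu : borel_prob R X, nu @ G --> mu.
  apply: (prokhorov (dm := dm) (dX := dX) dc qd) => k.
  exists (code_tight (w k)); apply: ooG; exists k => // j /= kj.
  by have [_ _ _] := H j; exact.
have cf f : integrals (nu j) f @[j --> G] --> integrals mu f.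
  exact: (@cvg_comp _ _ _ nu (fun m => integrals m f) _ _ _ numu
    (@integrals_continuous R X f mu)).
have nVmu : ~ V mu.
  move=> Vmu; have [_ Vbox _ _] := H 0%N.
  suff : (code_box (w 0%N) `&` V) mu by rewrite Vbox.
  split => // j jn; pose c : R :=
    (nth 0 (code_values (w 0%N)) j)%:~R / (code_size (w 0%N)).+1%:R.
  have cj : `|c - integrals (nu i) (test j)| @[i --> G] --> `|c - integrals mu (test j)|.
    by apply: cvg_norm; apply: cvgB; [exact: cvg_cst|exact: cf].
  have : lim (`|c - integrals (nu i) (test j)| @[i --> G])
      <= 1 / (code_size (w 0%N)).+1%:R.
    apply: limr_le; first by apply/cvg_ex; eexists; exact: cj.
    by apply: nearW => i; have [_ _ /(_ j jn) + _] := H i; rewrite -/c.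
  by rewrite (cvg_lim _ cj).
have /choice[g gP] (nK : nat * nat) : exists k, (nK.2 <= k)%N /\
    weak_ball q dm dX mu nK.1 (nu k).
  have G1 : G [set k | weak_ball q dm dX mu nK.1 (nu k)].
    exact: (numu _ (weak_ball_nbhs q dm dX mu nK.1)).
  have G2 : G [set k | (nK.2 <= k)%N] by apply: ooG; exists nK.2.
  by have [k [? ?]] := filter_ex (filterI G2 G1); exists k.
(* Each index is sought beyond the previous one and in the next smaller ball. *)
pose t := fix t n := if n is n'.+1 then g (n, (t n').+1) else g (0%N, 0%N).
have tS n : (t n < t n.+1)%N by have [] := gP (n.+1, (t n).+1).
have tP n : weak_ball q dm dX mu n (nu (t n)).
  by case: n => [|n]; [have [] := gP (0%N, 0%N)|have [] := gP (n.+1, (t n).+1)].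
have s_incr : {homo s : i j / (i < j)%N} by apply: homo_ltn => //; exact: ltn_trans.
move=> /(_ mu) Gx; apply/nVmu/Gx; exists (s \o t).
  by apply: homo_ltn => [|n]; [exact: ltn_trans|apply: s_incr].
move=> O /(@weak_ball_base _ _ _ _ dm dX qd)[n0 n0O].
by exists n0 => // n /= n0n; apply: n0O; exact: subset_weak_ball n0n _ (tP n).
Qed.

(** A limit measure [mu] outside [V] has a weak ball missing [V]. Rounded integrals of [mu] give the
    box, and the single measure [mu] being tight makes late empirical measures tight at each
    scale. *)
Lemma witness_complete x : ~ G_ T V x -> exists w, forall k, witness k w x.
Proof.
move=> /existsNP[mu /not_implyP[[s s_incr smu] nVmu]].
have [n nV] : exists n, weak_ball q dm dX mu n `<=` ~` V.
  apply: (@weak_ball_base _ _ _ _ dm dX qd); apply: open_nbhs_nbhs.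
  by split => //; exact: closed_openC.
(* Rounding down to multiples of [n.+1^-1] has error strictly below the tolerance, so empirical
   measures close to [mu] also lie in the box. *)
pose c := mkseq (fun j => Num.floor (integrals mu (test j) * n.+1%:R)) n.
have cf f : integrals (empirical_prob R T x (s j)) f @[j --> \oo] --> integrals mu f.
  exact: (@cvg_comp _ _ _ (fun j => empirical_prob R T x (s j))
    (fun m => integrals m f) _ _ _ smu (@integrals_continuous R X f mu)).
have n0 : 0 < n.+1%:R :> R by [].
have cmu j : (j < n)%N ->
    `|(nth 0 c j)%:~R / n.+1%:R - integrals mu (test j)| < 1 / n.+1%:R.
  move=> jn; rewrite nth_mkseq//; set a := integrals mu _.
  have /andP[f1 f2] := floor_itv (a * n.+1%:R).
  rewrite -{2}[a](mulfK (lt0r_neq0 n0)) -mulrBl normrM (gtr0_norm (_ : 0 < n.+1%:R^-1))//.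
  rewrite ltr_pM2r ?invr_gt0// ltr_norml; move: f1 f2; rewrite intrD.
  by set b := a * _ => ? ?; apply/andP; split; lra.
have [K' _ K'P] : \forall k \near \oo, forall j : 'I_n,
    `|(nth 0 c j)%:~R / n.+1%:R - integrals (empirical_prob R T x (s k)) (test j)|
      < 1 / n.+1%:R.
  apply: filter_forall => j.
  have cj : `|(nth 0 c j)%:~R / n.+1%:R - integrals (empirical_prob R T x (s k)) (test j)|
      @[k --> \oo] --> `|(nth 0 c j)%:~R / n.+1%:R - integrals mu (test j)|.
    by apply: cvg_norm; apply: cvgB; [exact: cvg_cst|exact: cf].
  exact: (cvgr_lt _ cj _ (cmu j (ltn_ord j))).
have /choice[NK NKP] i : exists NK : nat * nat, forall k, (NK.2 <= k)%N ->
    1 - 2 ^- i <= integrals (empirical_prob R T x (s k)) (tightf i NK.1).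
  (* Half of the allowed loss goes to choosing finitely many balls for [mu], the other half to the
     convergence of the integrals. *)
  have i0 : 0 < 2 ^- i / 2 :> R by rewrite !divr_gt0// invr_gt0 exprn_gt0.
  have [|N NP] := @mass_le_testf _ _ d q dm dX mu (fun p => p.2 == i) setT _ openT _ i0.
    move=> y _; have i1 : 0 < 2 ^- i :> R by rewrite invr_gt0 exprn_gt0.
    have [j jy] := qd y i1.
    by exists (j, i).
  have lt : 1 - 2 ^- i < integrals mu (tightf i N).
    by apply: lt_le_trans NP; rewrite massT; lra.
  have [K _ KP] := cvgr_gt _ (cf (tightf i N)) _ lt.
  by exists (N, K) => k /KP/ltW.
(* Beyond [K'] and the thresholds of all scales up to [k]; the summand [k] makes [t] strictly
   increasing. *)
pose t k := (k + \sum_(i < k.+1) (NK i).2 + K')%N.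
have tS k : (t k < t k.+1)%N.
  by rewrite /t [X in (_ < _ + X + _)%N]big_ord_recr/=; lia.
have tK i k : (i <= k)%N -> ((NK i).2 <= t k)%N.
  move=> ik; rewrite /t (bigD1 (Ordinal (ik : (i < k.+1)%N)))//=; lia.
exists (fun k => ((n, c, (NK k).1), s (t k))) => k; split.
- by case: k => // k _; apply: s_incr; exact: tS.
- apply/seteqP; split => // nu [box Vnu]; apply: (nV nu) => // j jn.
  have := cmu j jn; have := box j jn; rewrite /code_size /code_values/=.
  rewrite [2 / _](_ : _ = 1 / n.+1%:R + 1 / n.+1%:R); last by rewrite -mulrDl.
  rewrite distrC => le1 lt2.
  apply: le_lt_trans (ler_distD ((nth 0 c j)%:~R / n.+1%:R) _ _) _.
  by rewrite ltr_leD// distrC.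
- move=> j jn; apply: ltW; apply: (K'P (t k) _ (Ordinal jn)).
  by rewrite /= /t leq_addl.
- by move=> i ik; apply: NKP; exact: tK.
Qed.

Lemma coanalytic_G : coanalytic R (G_ T V).
Proof.
rewrite /coanalytic (_ : ~` _ = [set x | exists w, forall k, witness k w x]).
  by apply: (souslin_analytic dm dX dc qd witness_closed witness_local).
apply/seteqP; split => x; first exact: witness_complete.
by move=> [w]; exact: witness_sound.
Qed.

End fact19.

Theorem fact19 (R : realType) (X : ptopologicalType) (T : X -> X)
  (V : set (borel_prob R X)) :
  polish R X -> continuous T ->
  closed V -> V `<=` invariant_prob T ->
  coanalytic R (G_ T V).
Proof.
move=> [sX [d [dm dX dc]]] cT cV _.
have [q qd] := separable_dense_seq dm dX sX.
exact: (coanalytic_G cT cV dm dX dc qd).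
Qed.
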